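(* Let $n\ge 0$ be an integer and let $x,y$ be complex numbers such that no denominator below vanishes, i.e. $x\notin\{-1,\dots,-n\}$, $x-y\notin\{-1,\dots,-n\}$, $1+x-y\neq0$ and $y\notin\{1,0,-1,\dots,-n\}$. Then $$\sum_{k=0}^n(-1)^k\binom{n}{k}\frac{\binom{2x-y+n+k}{k}\binom{y+k}{k}}{\binom{x+k}{k}^2}\frac{(y-1)y}{(y+k-1)(y+k)}H_{k}^{\langle2\rangle}(x)$$ $$=\frac{n^2+n(1+2x-y)+(1+x-y)^2}{(1+x-y)^2}\,\frac{\binom{x-y+n}{n}^2}{\binom{x+n}{n}^2}\Big\{H_{n}^{\langle2\rangle}(x)-H_{n}^{\langle2\rangle}(x-y)\Big\}+\frac{n^2+n(1+2x-y)}{(1+x-y)^4}\,\frac{\binom{x-y+n}{n}^2}{\binom{x+n}{n}^2}.$$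
   Context: For a complex number $u$ and an integer $k\ge 0$, $\binom{u}{k}=\frac{u(u-1)\cdots(u-k+1)}{k!}$ (equal to $1$ for $k=0$). For a complex number $u$ and a positive integer $\ell$, the generalized harmonic numbers of $\ell$-order are $H_0^{\langle\ell\rangle}(u)=0$ and $H_n^{\langle\ell\rangle}(u)=\sum_{k=1}^n\frac{1}{(u+k)^\ell}$ for $n\ge1$. *)

(* Defs.v *)
From HB Require Import structures.
From mathcomp Require Import all_boot all_order all_algebra.
From mathcomp Require Import reals complex.

Set Implicit Arguments.
Unset Strict Implicit.
Unset Printing Implicit Defensive.

Import Order.TTheory GRing.Theory Num.Theory.

Local Open Scope ring_scope.
Local Open Scope complex_scope.

Definition gbinom (F : numFieldType) (u : F) (k : nat) : F :=
  (\prod_(i < k) (u - i%:R)) / (k`!)%:R.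

(* The order [l] comes first: [gharm l n u] is the sum of 1 / (u + k)^l over
   1 <= k <= n. *)
Definition gharm (F : numFieldType) (l n : nat) (u : F) : F :=
  \sum_(1 <= k < n.+1) 1 / (u + k%:R) ^+ l.

(* Main.v *)
(* Replace the squares (x + i)^2 in the summand by (x + i)^2 - s. To first order
   in s this multiplies 1 / prod (x + i)^2 by 1 + s H^<2>(x), so the theorem is
   the coefficient of s in an evaluation of the terminating series
   3F2(-n, 2x-y+n+1, y-1; x+1+t, x+1-t; 1), with s = t^2, whose parametric excess
   is 2. By (y-1)_k = (y)_k - k (y)_(k-1) this series is a combination of two
   Saalschuetzian ones. Clearing denominators turns everything into polynomial
   identities valid in every commutative ring, and Saalschuetz' formula itself
   then follows by induction on n from Pascal's rule. *)
Require Import Defs.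
From HB Require Import structures.
From mathcomp Require Import all_boot all_order all_algebra.
From mathcomp Require Import reals complex.
From mathcomp Require Import ring.

Set Implicit Arguments.
Unset Strict Implicit.
Unset Printing Implicit Defensive.

Import Order.TTheory GRing.Theory Num.Theory.

Local Open Scope ring_scope.
Local Open Scope complex_scope.

Definition rising (K : comNzRingType) (a : K) (k : nat) : K :=
  \prod_(0 <= i < k) (a + i%:R).

(** With s = t^2 and m = 0 this is (x+1+t)_n (x+1-t)_n. The lower bound [m] serves to clear
    denominators: [sqprod s x 0 n] over [sqprod s x 0 k] is [sqprod s x k n]. *)
Definition sqprod (K : comNzRingType) (s x : K) (m n : nat) : K :=
  \prod_(m <= i < n) ((x + i.+1%:R) ^+ 2 - s).

(* [sqprod s x 0 n] times the terminating series 3F2(-n, a, b; x+1+t, x+1-t; 1),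
   where s = t^2. *)
Definition hypsum (K : comNzRingType) (s : K) (n : nat) (a b x : K) : K :=
  \sum_(0 <= k < n.+1)
    (-1) ^+ k * 'C(n, k)%:R * rising a k * rising b k * sqprod s x k n.

(** * Saalschuetz' formula and its analogue of excess 2, as polynomial identities *)

Section CommutativeRing.

Variable K : comNzRingType.
Implicit Types (a b x y s : K) (k m n : nat).

Lemma rising0 a : rising a 0 = 1.
Proof. by rewrite /rising big_geq. Qed.

Lemma risingS a k : rising a k.+1 = rising a k * (a + k%:R).
Proof. by rewrite /rising big_nat_recr. Qed.

Lemma risingSl a k : rising a k.+1 = a * rising (a + 1) k.
Proof.
rewrite /rising big_nat_recl // addr0; congr (_ * _).
by apply: eq_bigr => i _; rewrite -addrA nat1r.
Qed.

Lemma sqprod_shift s x m n : sqprod s (x + 1) m n = sqprod s x m.+1 n.+1.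
Proof.
rewrite /sqprod big_add1 /=.
by apply: eq_bigr => i _; rewrite -addrA nat1r.
Qed.

Lemma sqprod_ltn s x m n : (m < n)%N ->
  sqprod s x m n = ((x + m.+1%:R) ^+ 2 - s) * sqprod s x m.+1 n.
Proof. by move=> ltmn; rewrite /sqprod big_ltn. Qed.

Lemma sqprodS s x m n : (m <= n)%N ->
  sqprod s x m n.+1 = sqprod s x m n * ((x + n.+1%:R) ^+ 2 - s).
Proof. by move=> lemn; rewrite /sqprod big_nat_recr. Qed.

(** Pascal's rule splits the sum in two. After an index shift the terms at [k] differ only in one
    factor; in the difference of these factors k^2 cancels, so it is affine in k. *)
Lemma hypsumS s n a b x :
  hypsum s n.+1 a b x =
  \sum_(0 <= k < n.+1)
    (-1) ^+ k * 'C(n, k)%:R * rising a k * rising b k * sqprod s (x + 1) k n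
    * ((x + k.+1%:R) ^+ 2 - s - (a + k%:R) * (b + k%:R)).
Proof.
pose f k := (-1) ^+ k * 'C(n, k)%:R * rising a k * rising b k
            * sqprod s x k n.+1.
pose g k := (-1) ^+ k * 'C(n, k)%:R * rising a k.+1 * rising b k.+1
            * sqprod s x k.+1 n.+1.
have fE : \sum_(0 <= k < n.+2) f k = \sum_(0 <= k < n.+1) f k.
  by rewrite big_nat_recr //= /f bin_small // mulr0 !mul0r addr0.
rewrite /hypsum big_nat_recl // -/(f 0).
transitivity (\sum_(0 <= k < n.+2) f k - \sum_(0 <= k < n.+1) g k).
  rewrite [in RHS]big_nat_recl // -addrA -sumrB; congr (_ + _).
    by rewrite /f !bin0.
  apply: eq_bigr => k _.
  by rewrite /f /g binS natrD exprS; ring.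
rewrite fE -sumrB; apply: eq_big_nat => k /andP[_ ltkn].
by rewrite /f /g !risingS sqprod_shift sqprod_ltn //; ring.
Qed.

(* From (b)_k = (b+1)_k - k (b+1)_(k-1). *)
Lemma hypsum_contiguous s n a b x :
  hypsum s n.+1 a b x =
  hypsum s n.+1 a (b + 1) x + n.+1%:R * a * hypsum s n (a + 1) (b + 1) (x + 1).
Proof.
rewrite {1 2}/hypsum !(big_nat_recl n.+1) // !rising0 -addrA; congr (_ + _).
rewrite /hypsum mulr_sumr -big_split; apply: eq_bigr => k _ /=.
(* This absorbs the factor k + 1 of the contiguous relation and lowers the order of the second sum
   to n. *)
have binE : (k.+1%:R * 'C(n.+1, k.+1)%:R = n.+1%:R * 'C(n, k)%:R :> K).
  by rewrite -!natrM mul_bin_diag.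
rewrite -sqprod_shift (risingSl b) (risingSl a) (risingS (b + 1)) exprS.
transitivity (-1 * (-1) ^+ k * 'C(n.+1, k.+1)%:R * (a * rising (a + 1) k)
     * (rising (b + 1) k * (b + 1 + k%:R)) * sqprod s (x + 1) k n
   + a * (k.+1%:R * 'C(n.+1, k.+1)%:R) * (-1) ^+ k * rising (a + 1) k
     * rising (b + 1) k * sqprod s (x + 1) k n); first by rewrite -natr1; ring.
by rewrite binE; congr (_ + _); ring.
Qed.

Lemma hypsum_saalschutz s n x y :
  hypsum s n (2 * x - y + n%:R + 1) y x = sqprod s (x - y) 0 n.
Proof.
elim/ltn_ind: n x y => n IH x y; case: n IH => [|n] IH.
  by rewrite /hypsum big_nat1 bin0 !rising0 /sqprod !big_geq // !mulr1.
rewrite hypsumS; set a := 2 * x - y + _ + 1.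
(* For this [a] the affine factor of [hypsumS] is (x-y+1)^2 - s - n(y+k), and (y)_k (y+k) = y
   (y+1)_k. *)
transitivity (((x - y + 1) ^+ 2 - s) * hypsum s n a y (x + 1)
              - n%:R * y * hypsum s n a (y + 1) (x + 1)).
  rewrite /hypsum !mulr_sumr -sumrB; apply: eq_bigr => k _.
  have -> : n%:R * y * ((-1) ^+ k * 'C(n, k)%:R * rising a k
              * rising (y + 1) k * sqprod s (x + 1) k n)
    = n%:R * ((-1) ^+ k * 'C(n, k)%:R * rising a k
              * (y * rising (y + 1) k) * sqprod s (x + 1) k n) by ring.
  by rewrite -risingSl risingS /a -!natr1; ring.
have saal1 : hypsum s n a (y + 1) (x + 1) = sqprod s (x - y) 0 n.
  rewrite -(_ : x + 1 - (y + 1) = x - y); last by ring.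
  rewrite -IH //; congr (hypsum s n _ _ _); rewrite /a -natr1; ring.
rewrite saal1; case: n IH @a saal1 => [|n] IH a saal1.
  rewrite /hypsum big_nat1 bin0 !rising0 sqprodS // /sqprod !big_geq //.
  by ring.
(* The remaining sum has excess 2. Raising [y] to [y + 1] turns it into the sum of [saal1] plus a
   Saalschuetzian sum two orders below the goal, hence the strong induction. *)
rewrite hypsum_contiguous saal1.
have -> : hypsum s n (a + 1) (y + 1) (x + 1 + 1) = sqprod s (x - y) 1 n.+1.
  rewrite -sqprod_shift -(_ : x + 1 + 1 - (y + 1) = x - y + 1); last by ring.
  rewrite -IH //; congr (hypsum s n _ _ _); rewrite /a -!natr1; ring.
rewrite [in RHS]sqprodS // !(sqprod_ltn _ _ (ltn0Sn n)) /a -!natr1; ring.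
Qed.

(** Raising [y - 1] to [y] gives Saalschuetzian sums of orders n+1 and n, whose values share the
    product from index 1 on. *)
Lemma hypsum_excess2 s n x y :
  hypsum s n.+1 (2 * x - y + n.+1%:R + 1) (y - 1) x =
  ((x - y + 1) ^+ 2 - s + n.+1%:R * (2 * x - y + n.+1%:R + 1))
  * sqprod s (x - y) 1 n.+1.
Proof.
rewrite hypsum_contiguous subrK hypsum_saalschutz sqprod_ltn //.
have -> : 2 * x - y + n.+1%:R + 1 + 1 = 2 * (x + 1) - y + n%:R + 1.
  by rewrite -natr1; ring.
rewrite hypsum_saalschutz (addrAC x 1) sqprod_shift; ring.
Qed.

End CommutativeRing.

(** * Extraction of the coefficient of s, and translation into binomials *)

Section NumField.

Variable F : numFieldType.
Implicit Types (u x y : F) (k m n : nat).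

Lemma rising_polyC u k : rising u%:P k = (rising u k)%:P.
Proof.
by rewrite /rising rmorph_prod; apply: eq_bigr => i _; rewrite rmorphD rmorph_nat.
Qed.

Lemma coef1M (p q : {poly F}) : (p * q)`_1 = p`_0 * q`_1 + p`_1 * q`_0.
Proof. by rewrite coefM !big_ord_recl big_ord0 addr0. Qed.

Lemma coef0_sqprod x m n : (sqprod 'X x%:P m n)`_0 = sqprod 0 x m n.
Proof.
rewrite /sqprod -horner_coef0 horner_prod; apply: eq_bigr => i _.
by rewrite -polyC_natr !hornerE.
Qed.

(** The logarithmic derivative at s = 0, where s is the indeterminate: the factor (x+i+1)^2 - s
    contributes -1/(x+i+1)^2. *)
Lemma coef1_sqprod x m n : (m <= n)%N ->
    (forall i, (m <= i < n)%N -> x + i.+1%:R != 0) ->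
  (sqprod 'X x%:P m n)`_1 =
  - sqprod 0 x m n * \sum_(m <= i < n) 1 / (x + i.+1%:R) ^+ 2.
Proof.
elim: n => [|n IH].
  by rewrite leqn0 => /eqP-> _; rewrite /sqprod !big_geq // coef1 mulr0.
rewrite leq_eqVlt => /predU1P[-> _|].
  by rewrite /sqprod !big_geq // coef1 mulr0.
rewrite ltnS => lemn nz.
have nzn : x + n.+1%:R != 0 by apply: nz; rewrite lemn /=.
rewrite !sqprodS // coef1M coef0_sqprod IH // => [|i /andP[lemi ltin]]; last first.
  by apply: nz; rewrite lemi ltnW.
rewrite big_nat_recr //= -polyC_natr -polyCD -polyC_exp !coefB !coefC !coefX /=.
by move: nzn; set c := x + _ => nzn; field; exact: nzn.
Qed.

Lemma gharm2E n x : gharm 2 n x = \sum_(0 <= i < n) 1 / (x + i.+1%:R) ^+ 2.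
Proof. by rewrite /gharm big_add1. Qed.

Lemma gbinom_rising u k : gbinom (u + k%:R) k = rising (u + 1) k / k`!%:R.
Proof.
rewrite /gbinom /rising big_mkord (reindex_inj rev_ord_inj) /=.
congr (_ / _); apply: eq_bigr => i _.
rewrite natrB // -natr1; ring.
Qed.

Lemma rising_sqprod x k : rising (x + 1) k ^+ 2 = sqprod 0 x 0 k.
Proof.
rewrite /rising /sqprod -prodrXl; apply: eq_bigr => i _.
by rewrite subr0 -addrA nat1r.
Qed.

(* The coefficient of s in [hypsum_excess2]. *)
Lemma harmonic_hypsum n x y :
    (forall i, (i < n)%N -> x + i.+1%:R != 0) ->
    (forall i, (i < n)%N -> x - y + i.+1%:R != 0) ->
    x - y + 1 != 0 ->
  let a := 2 * x - y + n%:R + 1 in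
  let w := x - y + 1 in
  \sum_(0 <= k < n.+1)
    (-1) ^+ k * 'C(n, k)%:R * rising a k * rising (y - 1) k * sqprod 0 x k n
    * gharm 2 k x =
  (n%:R * a + w ^+ 2) / w ^+ 2 * sqprod 0 (x - y) 0 n
    * (gharm 2 n x - gharm 2 n (x - y))
  + n%:R * a / w ^+ 4 * sqprod 0 (x - y) 0 n.
Proof.
case: n => [|n] nzx nzxy nzw a w.
  by rewrite big_nat1 !gharm2E !big_geq // subr0 !mulr0 !mul0r addr0.
pose c k : F := (-1) ^+ k * 'C(n.+1, k)%:R * rising a k * rising (y - 1) k.
have polyE : \sum_(0 <= k < n.+2) (c k)%:P * sqprod 'X x%:P k n.+1 =
    ((w ^+ 2 + n.+1%:R * a)%:P - 'X) * sqprod 'X (x - y)%:P 1 n.+1.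
  have := hypsum_excess2 'X n x%:P y%:P.
  have -> : 2 * x%:P - y%:P + n.+1%:R + 1 = a%:P.
    by rewrite /a !(polyCD, polyCN, polyCM, polyC_natr).
  rewrite -polyCB -polyC1 -polyCB -polyCD /hypsum => hE.
  transitivity (((w ^+ 2)%:P - 'X + n.+1%:R * a%:P)
                * sqprod 'X (x - y)%:P 1 n.+1); last first.
    by rewrite (polyCD (w ^+ 2)) (polyCM n.+1%:R) polyC_natr addrAC.
  rewrite polyC_exp -hE; apply: eq_bigr => k _.
  by rewrite !rising_polyC /c !polyCM polyC_natr polyC_exp polyCN.
have /(congr1 (fun p : {poly F} => p`_0)) := polyE.
rewrite coef0M coefB coefC coefX subr0 /= coef0_sqprod coef_sum => eq0.
have /(congr1 (fun p : {poly F} => p`_1)) := polyE.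
rewrite coef1M !coefB !coefC !coefX /= subr0 sub0r coef0_sqprod coef_sum.
rewrite coef1_sqprod // => [eq1|i /andP[_ ltin]]; last exact: nzxy.
(* The linear coefficient of [sqprod] from k to n+1 carries minus the tail of the harmonic sum;
   adding the full sum times the constant coefficient leaves the sum up to k. *)
have -> : \sum_(0 <= k < n.+2) (-1) ^+ k * 'C(n.+1, k)%:R * rising a k
      * rising (y - 1) k * sqprod 0 x k n.+1 * gharm 2 k x =
    gharm 2 n.+1 x
      * (\sum_(0 <= k < n.+2) ((c k)%:P * sqprod 'X x%:P k n.+1)`_0)
    + \sum_(0 <= k < n.+2) ((c k)%:P * sqprod 'X x%:P k n.+1)`_1.
  rewrite mulr_sumr -big_split; apply: eq_big_nat => k /andP[_ lekn] /=.
  rewrite !coefCM coef0_sqprod coef1_sqprod // => [|i /andP[_]]; last exact: nzx.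
  by rewrite !gharm2E (big_cat_nat (n := k) (p := n.+1)) //= /c; ring.
(* The product and the harmonic sum at x - y both start at index 1. Restoring the factor w^2 and the
   term 1/w^2 produces the denominators and the last summand n a / w^4. *)
rewrite eq0 eq1 (sqprod_ltn _ _ (ltn0Sn n)) subr0 (gharm2E _ (x - y)).
rewrite (big_ltn (ltn0Sn n)) -/w; field.
exact: nzw.
Qed.

(** Two factors can be split off (y-1)_(k+2) at the bottom or at the top. The rational factor of the
    summand thus lowers the parameter y+1 to y-1. *)
Lemma gbinom_lower_rising y k : y + k%:R != 0 -> y + k%:R - 1 != 0 ->
  gbinom (y + k%:R) k * (((y - 1) * y) / ((y + k%:R - 1) * (y + k%:R))) =
  rising (y - 1) k / k`!%:R.
Proof.
move=> nz1 nz2.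
have risingE : (y - 1) * y * rising (y + 1) k
    = rising (y - 1) k * ((y + k%:R - 1) * (y + k%:R)).
  have -> : (y - 1) * y * rising (y + 1) k = rising (y - 1) k.+2.
    by rewrite !risingSl subrK mulrA.
  by rewrite !risingS -natr1; ring.
have nzf : k`!%:R != 0 :> F by rewrite pnatr_eq0 -lt0n fact_gt0.
rewrite gbinom_rising.
transitivity ((y - 1) * y * rising (y + 1) k / ((y + k%:R - 1) * (y + k%:R))
              / k`!%:R); first by field; rewrite nz1 nz2 nzf.
by rewrite risingE mulfK // mulf_neq0.
Qed.

End NumField.

Theorem theorem4 (R : realType) (n : nat) (x y : R[i])
  (hx : forall k : nat, (1 <= k <= n)%N -> x <> - k%:R)
  (hxy : forall k : nat, (1 <= k <= n)%N -> x - y <> - k%:R)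
  (hxy1 : 1 + x - y <> 0)
  (hy1 : y <> 1)
  (hy : forall k : nat, (k <= n)%N -> y <> - k%:R) :
  \sum_(0 <= k < n.+1)
     (-1) ^+ k * 'C(n, k)%:R
     * ((gbinom (2 * x - y + n%:R + k%:R) k * gbinom (y + k%:R) k)
        / gbinom (x + k%:R) k ^+ 2)
     * (((y - 1) * y) / ((y + k%:R - 1) * (y + k%:R)))
     * gharm 2 k x
  = (n%:R ^+ 2 + n%:R * (1 + 2 * x - y) + (1 + x - y) ^+ 2) / (1 + x - y) ^+ 2
    * (gbinom (x - y + n%:R) n ^+ 2 / gbinom (x + n%:R) n ^+ 2)
    * (gharm 2 n x - gharm 2 n (x - y))
  + (n%:R ^+ 2 + n%:R * (1 + 2 * x - y)) / (1 + x - y) ^+ 4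
    * (gbinom (x - y + n%:R) n ^+ 2 / gbinom (x + n%:R) n ^+ 2).
Proof.
have nzx i : (i < n)%N -> x + i.+1%:R != 0.
  by move=> ltin; rewrite addr_eq0; apply/eqP/hx.
have nzxy i : (i < n)%N -> x - y + i.+1%:R != 0.
  by move=> ltin; rewrite addr_eq0; apply/eqP/hxy.
have nzy k : (k <= n)%N -> y + k%:R != 0.
  by move=> lekn; rewrite addr_eq0; apply/eqP/hy.
have nzy1 k : (k <= n)%N -> y + k%:R - 1 != 0.
  case: k => [_|k ltkn]; first by rewrite addr0 subr_eq0; apply/eqP.
  by rewrite -natr1 addrA addrK nzy // ltnW.
have nzf k : k`!%:R != 0 :> R[i] by rewrite pnatr_eq0 -lt0n fact_gt0.
have wE : 1 + x - y = x - y + 1 by ring.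
have nzw : x - y + 1 != 0 by rewrite -wE; apply/eqP.
have nzsq m k : (k <= n)%N -> sqprod 0 x m k != 0.
  move=> lekn; rewrite /sqprod prodf_seq_neq0; apply/allP => i.
  rewrite mem_index_iota => /andP[_ ltik].
  by rewrite subr0 expf_neq0 // nzx // (leq_trans ltik).
have quotE : gbinom (x - y + n%:R) n ^+ 2 / gbinom (x + n%:R) n ^+ 2
    = sqprod 0 (x - y) 0 n / sqprod 0 x 0 n.
  rewrite !gbinom_rising !expr_div_n !rising_sqprod.
  by field; rewrite nzsq // nzf.
have := harmonic_hypsum nzx nzxy nzw; set a := 2 * x - y + n%:R + 1 => /= hE.
rewrite quotE wE.
(* Dividing [hE] by [sqprod 0 x 0 n] undoes the clearing of denominators; n a = n^2 + n(1+2x-y). *)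
transitivity ((\sum_(0 <= k < n.+1)
    (-1) ^+ k * 'C(n, k)%:R * rising a k * rising (y - 1) k * sqprod 0 x k n
    * gharm 2 k x) / sqprod 0 x 0 n); last first.
  by rewrite hE /a; field; rewrite nzw nzsq.
rewrite mulr_suml; apply: eq_big_nat => k /andP[_ lekn].
transitivity ((-1) ^+ k * 'C(n, k)%:R * gbinom (2 * x - y + n%:R + k%:R) k
    * (gbinom (y + k%:R) k * (((y - 1) * y) / ((y + k%:R - 1) * (y + k%:R))))
    / gbinom (x + k%:R) k ^+ 2 * gharm 2 k x); first by ring.
(* The two k! of the numerator cancel the square of the one in the denominator, and the product up
   to n splits at k. *)
rewrite gbinom_lower_rising ?nzy ?nzy1 // !gbinom_rising -/a expr_div_n.
rewrite rising_sqprod [sqprod 0 x 0 n](_ : _ = sqprod 0 x 0 k * sqprod 0 x k n).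
  by field; rewrite !nzsq // nzf.
by rewrite /sqprod -big_cat_nat.
Qed.
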